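(* $L_\infty[0,1]$ admits an equivalent rearrangement-invariant norm whose restriction to every reflexive subspace of $L_\infty[0,1]$ is a $W2R$ norm.
   Context: A norm $\|\cdot\|$ on a Banach space $X$ is weakly $2$-rotund ($W2R$) if for every sequence $(x_n)\subset X$ with $\|x_n\|\le 1$ for all $n$ and $\lim_{m,n\to\infty}\|x_m+x_n\|=2$ there is $x\in X$ with $x_n\to x$ weakly. A norm on a space of (classes of) measurable functions on $[0,1]$ is rearrangement-invariant if it is a lattice norm ($|f|\le|g|$ a.e. implies $\|f\|\le\|g\|$) and $\|f\|=\|g\|$ whenever $|f|$ and $|g|$ have the same distribution with respect to Lebesgue measure. *)

(* Defs.v *)
From HB Require Import structures.
From mathcomp Require Import all_boot all_order all_algebra.
From mathcomp Require Import all_classical all_reals all_analysis.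
From mathcomp Require Import measurable_realfun ess_sup_inf.

Set Implicit Arguments.
Unset Strict Implicit.
Unset Printing Implicit Defensive.

Import Order.TTheory GRing.Theory Num.Theory.
Import numFieldNormedType.Exports.

Local Open Scope classical_set_scope.
Local Open Scope ring_scope.

(* [LspaceType mu p1] is the library's L^p space of classes of functions modulo
   a.e. equality; the library gives it neither algebraic operations nor a norm.
   They are defined here on representatives. *)
Section Lspace_normed.
Context d (T : measurableType d) (R : realType).
Variables (mu : {measure set T -> \bar R}) (p : \bar R) (p1 : (1 <= p)%E).

Local Notation L := (LspaceType mu p1).

HB.instance Definition _ := gen_eqMixin L.
HB.instance Definition _ := gen_choiceMixin L.

Lemma ae_eq_Lnorm (f g : T -> R) :
  measurable_fun setT f -> measurable_fun setT g -> f = g %[ae mu] ->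
  'N[mu]_p[EFin \o f]%E = 'N[mu]_p[EFin \o g]%E.
Proof.
have mE (r : R) (h : T -> R) : measurable_fun setT h ->
    measurable_fun setT (fun x => `|(EFin \o h) x| `^ r)%E.
  move=> mh; apply: (@measurableT_comp _ _ _ _ _ _ (fun x : \bar R => x `^ r)%E) => //.
    exact: measurable_poweR.
  by apply: measurableT_comp => //; exact/measurable_EFinP.
move=> mf mg fg; rewrite unlock /Lnorm; case: p => [r| |].
- congr (_ `^ _)%E; apply: ae_eq_integral => //; [exact: mE|exact: mE|].
  by apply: filterS fg => x /= + Tx => /(_ Tx) ->.
- case: ifPn => // _; apply: eq_ess_sup.
  by apply: filterS fg => x /(_ I) /= ->.
- case: ifPn => // _; apply: eq_ess_inf.
  by apply: filterS fg => x /(_ I) /= ->.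
Qed.

Local Open Scope quotient_scope.

Lemma repr_pi_ae (f : {mfun T >-> measurableTypeR R}) :
  repr (\pi_({mfun_ mu, T >-> measurableTypeR R}) f) = f %[ae mu].
Proof.
have : repr (\pi_({mfun_ mu, T >-> measurableTypeR R}) f) = f
  %[mod {mfun_ mu, T >-> measurableTypeR R}] by rewrite reprK.
by move=> /eqP; rewrite eqmodE => /asboolP.
Qed.

(* [{mfun T >-> R}] and [{mfun T >-> measurableTypeR R}] only differ by the
   measure display of the codomain. *)
Lemma mfunR_subproof (f : {mfun T >-> R}) :
  (f : T -> measurableTypeR R) \in @mfun _ _ T (measurableTypeR R).
Proof. by rewrite inE => mD B mB; exact: (measurable_funPT f). Qed.

Definition mfunR (f : {mfun T >-> R}) : {mfun T >-> measurableTypeR R} :=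
  mfun_Sub (mfunR_subproof f).

Definition pi_mfun (f : {mfun T >-> R}) : {mfun_ mu, T >-> measurableTypeR R} :=
  \pi_({mfun_ mu, T >-> measurableTypeR R}) (mfunR f).

Lemma measurable_aeEqMfun (x : {mfun_ mu, T >-> measurableTypeR R}) :
  measurable_fun setT (x : T -> R).
Proof. by move=> mD B mB; exact: (measurable_funPT (repr x)). Qed.

Lemma Lclass_finite (f : LfunType mu p1) :
  finite_norm mu p (pi_mfun f).
Proof.
rewrite /finite_norm (_ : 'N[mu]_p[_]%E = 'N[mu]_p[EFin \o f]%E).
  exact: Lfunction_finite.
apply: ae_eq_Lnorm; last exact: repr_pi_ae.
  exact: measurable_aeEqMfun.
exact: measurable_funPT.
Qed.

Definition Lclass (f : LfunType mu p1) : L :=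
  LebesgueSpace.Pack (LebesgueSpace.Class
    (isFinLebesgue.Build d T R mu p p1 _ (Lclass_finite f))).

Lemma Lrepr_subproof (x : L) : (x : T -> R) \in Lfun mu p.
Proof.
apply/andP; split; rewrite inE; last exact: Lebesgue_finite.
exact: measurable_aeEqMfun.
Qed.

Definition Lrepr (x : L) : LfunType mu p1 := Lfun_Sub p1 (Lrepr_subproof x).

Lemma LspaceP (x y : L) : (x : T -> R) = y %[ae mu] -> x = y.
Proof.
case: x y => [x [[fx]]] [y [[fy]]] /= xy.
have e : x = y.
  rewrite -[x]reprK -[y]reprK.
  by apply/eqP; rewrite eqmodE; apply/asboolP.
by case: _ / e fy {xy} => fy; rewrite (bool_irrelevance fx fy).
Qed.

Lemma LreprK (x : L) : Lclass (Lrepr x) = x.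
Proof. exact/LspaceP/repr_pi_ae. Qed.

Lemma Lclass_ae (f : LfunType mu p1) : (Lclass f : T -> R) = f %[ae mu].
Proof. exact: repr_pi_ae. Qed.

Lemma eq_Lclass (f g : LfunType mu p1) :
  (f : T -> R) = g %[ae mu] -> Lclass f = Lclass g.
Proof.
move=> fg; apply: LspaceP.
apply: ae_eq_trans (Lclass_ae _) _.
exact: ae_eq_trans fg (ae_eq_sym (Lclass_ae _)).
Qed.

Let zero : L := Lclass 0.
Let opp (x : L) : L := Lclass (- Lrepr x).
Let add (x y : L) : L := Lclass (Lrepr x + Lrepr y).
Let scale (a : R) (x : L) : L := Lclass (a *: Lrepr x).

Let addA : associative add.
Proof.
move=> x y z; apply: eq_Lclass.
apply: filterS2 (Lclass_ae (Lrepr y + Lrepr z)) (Lclass_ae (Lrepr x + Lrepr y)).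
move=> t /(_ I) yz /(_ I) xy _.
change (x t + Lclass (Lrepr y + Lrepr z) t = Lclass (Lrepr x + Lrepr y) t + z t).
by rewrite yz xy; exact: addrA.
Qed.

Let addC : commutative add.
Proof. by move=> x y; rewrite /add addrC. Qed.

Let add0 : left_id zero add.
Proof.
move=> x; rewrite -[RHS]LreprK; apply: eq_Lclass.
apply: filterS (Lclass_ae 0) => t /(_ I) t0 _.
by change (Lclass 0 t + x t = x t); rewrite t0; exact: add0r.
Qed.

Let addN : left_inverse zero opp add.
Proof.
move=> x; apply: eq_Lclass.
apply: filterS (Lclass_ae (- Lrepr x)) => t /(_ I) xt _.
by change (Lclass (- Lrepr x) t + x t = 0); rewrite xt; exact: addNr.
Qed.

HB.instance Definition _ := GRing.isZmodule.Build L addA addC add0 addN.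

Let scaleA a b x : scale a (scale b x) = scale (a * b) x.
Proof.
apply: eq_Lclass.
apply: filterS (Lclass_ae (b *: Lrepr x)) => t /(_ I) xt _.
change (a *: Lclass (b *: Lrepr x) t = (a * b) *: x t).
by rewrite xt; exact: scalerA.
Qed.

Let scale1 : left_id 1 scale.
Proof. by move=> x; rewrite /scale scale1r LreprK. Qed.

Let scaleDr : right_distributive scale +%R.
Proof.
move=> a x y; apply: eq_Lclass.
apply: filterS3 (Lclass_ae (Lrepr x + Lrepr y)) (Lclass_ae (a *: Lrepr x))
  (Lclass_ae (a *: Lrepr y)) => t /(_ I) xy /(_ I) ax /(_ I) ay _.
change (a *: Lclass (Lrepr x + Lrepr y) t =
  Lclass (a *: Lrepr x) t + Lclass (a *: Lrepr y) t).
by rewrite xy ax ay; exact: scalerDr.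
Qed.

Let scaleDl x : {morph scale^~ x : a b / a + b}.
Proof.
move=> a b; apply: eq_Lclass.
apply: filterS2 (Lclass_ae (a *: Lrepr x)) (Lclass_ae (b *: Lrepr x)).
move=> t /(_ I) ax /(_ I) bx _.
change ((a + b) *: x t = Lclass (a *: Lrepr x) t + Lclass (b *: Lrepr x) t).
by rewrite ax bx; exact: scalerDl.
Qed.

HB.instance Definition _ :=
  GRing.Zmodule_isLmodule.Build R L scaleA scale1 scaleDr scaleDl.

Lemma Lspace0_ae : ((0 : L) : T -> R) = cst 0 %[ae mu].
Proof. exact: Lclass_ae. Qed.

Lemma LspaceN_ae (x : L) : ((- x : L) : T -> R) = \- x %[ae mu].
Proof. exact: Lclass_ae. Qed.

Lemma LspaceD_ae (x y : L) : ((x + y : L) : T -> R) = x \+ y %[ae mu].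
Proof. exact: Lclass_ae. Qed.

Lemma LspaceZ_ae (a : R) (x : L) :
  ((a *: x : L) : T -> R) = (fun t => a * x t) %[ae mu].
Proof. exact: Lclass_ae. Qed.

Let norm (x : L) : R := fine 'N[mu]_p[EFin \o x]%E.

Let norm_Lclass (f : LfunType mu p1) :
  norm (Lclass f) = fine 'N[mu]_p[EFin \o f]%E.
Proof.
rewrite /norm; congr fine; apply: ae_eq_Lnorm; last exact: Lclass_ae.
  exact: measurable_aeEqMfun.
exact: measurable_funPT.
Qed.

Let ler_normD x y : norm (x + y) <= norm x + norm y.
Proof. by rewrite norm_Lclass; exact: ler_LnormD. Qed.

Let normZ a x : norm (a *: x) = `|a| * norm x.
Proof.
rewrite norm_Lclass; apply: EFin_inj.
by rewrite finite_norm_fine LnormZ EFinM -(finite_norm_fine (Lrepr x)).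
Qed.

Let norm0_eq0 x : norm x = 0 -> x = 0.
Proof.
move=> /(fine_Lnormr_eq0 (f := Lrepr x)) x0.
by rewrite -[x]LreprK; exact: eq_Lclass.
Qed.

HB.instance Definition _ := Lmodule_isNormed.Build R L ler_normD normZ norm0_eq0.

Lemma Lspace_normE (x : L) : `|x| = fine 'N[mu]_p[EFin \o x]%E.
Proof. by []. Qed.

End Lspace_normed.

(* Lebesgue measure on [0, 1], seen as a measure on the real line carried by
   [0, 1]: a class modulo [leb01] is a class of functions on [0, 1]. The
   representatives are Borel; every Lebesgue measurable function is a.e. equal
   to a Borel one, so the classes are the usual ones. *)
Definition leb01 (R : realType) : {measure set (measurableTypeR R) -> \bar R} :=
  mrestr (@lebesgue_measure R) (measurable_itv `[0%R, 1%R]).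

Definition Linfty01 (R : realType) := LspaceType (leb01 R) (leey 1%E).

HB.instance Definition _ (R : realType) := NormedModule.on (Linfty01 R).

Record norm_on (R : realType) (V : lmodType R) := NormOn {
  norm_fun :> V -> R ;
  norm_onD : forall x y, norm_fun (x + y) <= norm_fun x + norm_fun y ;
  norm_onZ : forall a x, norm_fun (a *: x) = `|a| * norm_fun x ;
  norm_on_eq0 : forall x, norm_fun x = 0 -> x = 0 }.

Definition renormed (R : realType) (V : lmodType R) (N : norm_on V) : Type := V.

Section renormed.
Context (R : realType) (V : lmodType R) (N : norm_on V).
HB.instance Definition _ := GRing.Lmodule.on (renormed N).
HB.instance Definition _ :=
  Lmodule_isNormed.Build R (renormed N) (norm_onD N) (norm_onZ N)
    (@norm_on_eq0 _ _ N).
End renormed.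

(* The key [subspace_pred hE] lets the subtype instances be inferred for an
   arbitrary predicate; the norm is the restriction of that of V. *)
Section subspace_of.
Context (R : realType) (V : normedModType R).

Definition subspace_pred (E : {pred V}) (hE : submod_closed E) : {pred V} := E.

Context (E : {pred V}) (hE : submod_closed E).

HB.instance Definition _ :=
  GRing.isSubmodClosed.Build R V (subspace_pred hE) hE.

Record subspace_of : Type :=
  SubspaceOf { subspace_val :> V ; _ : subspace_val \in subspace_pred hE }.

HB.instance Definition _ := [isSub for subspace_val].
HB.instance Definition _ := [Choice of subspace_of by <:].
HB.instance Definition _ := [SubChoice_isSubLmodule of subspace_of by <:].

Let norm (x : subspace_of) : R := `|val x|.

Let ler_normD x y : norm (x + y) <= norm x + norm y.
Proof. exact: ler_normD. Qed.

Let normZ a x : norm (a *: x) = `|a| * norm x.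
Proof. exact: normrZ. Qed.

Let norm0_eq0 x : norm x = 0 -> x = 0.
Proof. by move=> /normr0_eq0 x0; exact: val_inj. Qed.

HB.instance Definition _ :=
  Lmodule_isNormed.Build R subspace_of ler_normD normZ norm0_eq0.

End subspace_of.

Section dual.
Context (R : realType) (V : normedModType R).

Definition dual_pred : {pred (V -> R^o)} :=
  mem [set f | linear f /\ continuous f].

Record dual : Type := Dual { dual_fun :> V -> R^o; _ : dual_fun \in dual_pred }.

HB.instance Definition _ := [isSub for dual_fun].
HB.instance Definition _ := [Choice of dual by <:].

Lemma dual_linear (f : dual) : linear f.
Proof. by case: f => f /=; rewrite inE => -[]. Qed.

Lemma dual_continuous (f : dual) : continuous f.
Proof. by case: f => f /=; rewrite inE => -[]. Qed.

Lemma dual_submod_closed : submod_closed dual_pred.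
Proof.
split.
  rewrite inE; split=> [a x y|]; last exact: cst_continuous.
  by rewrite /= scaler0 addr0.
move=> a f g; rewrite !inE => -[lf cf] [lg cg]; split=> [b x y|x].
  change (a *: f (b *: x + y) + g (b *: x + y) =
    b *: (a *: f x + g x) + (a *: f y + g y)).
  by rewrite lf lg !scalerDr !scalerA (mulrC a) addrACA.
apply: cvgD; last exact: cg.
by apply: cvgZl_tmp; exact: cf.
Qed.

HB.instance Definition _ :=
  GRing.isSubmodClosed.Build _ _ dual_pred dual_submod_closed.
HB.instance Definition _ := [SubChoice_isSubLmodule of dual by <:].

HB.instance Definition _ (f : dual) :=
  GRing.isLinear.Build R V R^o *:%R (f : V -> R^o) (dual_linear f).

Definition dual_norm (f : dual) : R :=
  sup [set `|f x| | x in [set x | `|x| <= 1]].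

Lemma dual_bounded (f : dual) : exists M, forall x, `|f x| <= M * `|x|.
Proof.
have /linear_bounded_continuous/linear_boundedP := @dual_continuous f.
by move=> /pinfty_ex_gt0[M _ fM]; exists M.
Qed.

Lemma dual_norm_has_sup (f : dual) : has_sup [set `|f x| | x in [set x | `|x| <= 1]].
Proof.
have [M fM] := dual_bounded f; split.
  by exists `|f 0|; exists 0 => //=; rewrite normr0.
exists `|M| => _ [x /= x1 <-].
rewrite (le_trans (fM x))// (le_trans (ler_norm _))// normrM normr_id.
by rewrite ler_piMr.
Qed.

Lemma le_dual_norm (f : dual) x : `|f x| <= dual_norm f * `|x|.
Proof.
have [->|x0] := eqVneq x 0; first by rewrite linear0 !normr0 mulr0.
have nx0 : 0 < `|x| by rewrite normr_gt0.
rewrite -ler_pdivrMr//.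
have <- : `|f (`|x|^-1 *: x)| = `|f x| / `|x|.
  by rewrite linearZ/= normrZ normfV normr_id mulrC.
apply: (ub_le_sup (dual_norm_has_sup f).2); exists (`|x|^-1 *: x) => //=.
by rewrite normrZ normfV normr_id mulVf// gt_eqF.
Qed.

Lemma dual_norm_le (f : dual) M :
  (forall x, `|x| <= 1 -> `|f x| <= M) -> dual_norm f <= M.
Proof.
move=> fM; apply: ge_sup; first exact: (dual_norm_has_sup f).1.
by move=> _ [x /= /fM ? <-].
Qed.

Lemma dual_norm_ge0 (f : dual) : 0 <= dual_norm f.
Proof.
apply: (le_trans (normr_ge0 (f 0))).
by apply: (ub_le_sup (dual_norm_has_sup f).2); exists 0; rewrite //= normr0.
Qed.

Let ler_dual_normD f g : dual_norm (f + g) <= dual_norm f + dual_norm g.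
Proof.
apply: dual_norm_le => x x1; rewrite (le_trans (ler_normD (f x) (g x)))//.
by apply: lerD; apply: (ub_le_sup (dual_norm_has_sup _).2); exists x.
Qed.

Let dual_normZ_le a f : dual_norm (a *: f) <= `|a| * dual_norm f.
Proof.
apply: dual_norm_le => x x1; rewrite [leLHS](normrM a (f x)) ler_wpM2l//.
by apply: (ub_le_sup (dual_norm_has_sup _).2); exists x.
Qed.

Let dual_normZ a f : dual_norm (a *: f) = `|a| * dual_norm f.
Proof.
have [->|a0] := eqVneq a 0.
  by rewrite normr0 mul0r; apply/eqP; rewrite eq_le dual_norm_ge0 andbT
    (le_trans (dual_normZ_le _ _))// normr0 mul0r.
apply/eqP; rewrite eq_le dual_normZ_le/=.
rewrite -ler_pdivlMl ?normr_gt0// -normfV.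
by rewrite -{1}[f](scalerK a0) dual_normZ_le.
Qed.

Let dual_norm_eq0 f : dual_norm f = 0 -> f = 0.
Proof.
move=> f0; apply: val_inj; apply: funext => x.
apply/eqP; rewrite -normr_le0 (le_trans (le_dual_norm f x))//.
by rewrite f0 mul0r.
Qed.

HB.instance Definition _ :=
  Lmodule_isNormed.Build R dual ler_dual_normD dual_normZ dual_norm_eq0.

End dual.

(* The canonical embedding of V into its bidual is onto. *)
Definition reflexive_space (R : realType) (V : normedModType R) : Prop :=
  forall Phi : dual (dual V), exists x : V, forall f : dual V, Phi f = f x.

Definition weak_cvg (R : realType) (V : normedModType R) (x : V^nat) (l : V) :
    Prop :=
  forall f : dual V, f (x n) @[n --> \oo] --> f l.

Definition W2R (R : realType) (V : normedModType R) : Prop :=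
  forall x : V^nat, (forall n, `|x n| <= 1) ->
    `|x mn.1 + x mn.2| @[mn --> (\oo, \oo)] --> (2 : R) ->
    exists l : V, weak_cvg x l.

Definition equivalent_norm (R : realType) (V : normedModType R)
    (N : norm_on V) : Prop :=
  exists c C : R, [/\ 0 < c, 0 < C & forall x, c * `|x| <= N x <= C * `|x|].

(* "Same distribution" of |f| and |g|: equal image measures on Borel sets. *)
Definition rearrangement_invariant (R : realType) (N : norm_on (Linfty01 R)) :
    Prop :=
  (forall f g : Linfty01 R,
    (\forall t \ae leb01 R, `|f t| <= `|g t|) -> N f <= N g) /\
  (forall f g : Linfty01 R,
    (forall B : set R, measurable B ->
      leb01 R [set t | B `|f t|] = leb01 R [set t | B `|g t|]) ->
    N f = N g).

(* Main.v *)
(** On [L_infty], take [N f ^ 2 = |f|_infty ^ 2 + |f|_2 ^ 2], which is equivalent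
    and rearrangement-invariant. If [N (x_n) <= 1] and [N (x_m + x_n) -> 2], the
    parallelogram law forces [(x_n)] to be Cauchy in [L_2], so that every
    functional [<w, .>] with [w] bounded converges along it. On a reflexive
    subspace these functionals separate points, and every ultrafilter on the
    indices yields a weak limit of [(x_n)] in the subspace; all these limits agree
    on the functionals [<w, .>], hence coincide, and [(x_n)] converges weakly. *)

Require Import Defs.
From HB Require Import structures.
From mathcomp Require Import all_boot all_order all_algebra.
From mathcomp Require Import all_classical all_reals all_analysis.
From mathcomp Require Import measurable_realfun ess_sup_inf.
From mathcomp Require Import ring lra.

Set Implicit Arguments.
Unset Strict Implicit.
Unset Printing Implicit Defensive.

Import Order.TTheory GRing.Theory Num.Theory.
Import numFieldNormedType.Exports.

Local Open Scope classical_set_scope.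
Local Open Scope ring_scope.

(** * Convergence along ultrafilters *)

(** If the preimage of a neighbourhood of [l] is not in [F], its complement can be added to [F], and
    an ultrafilter above the result contradicts the assumed convergence. *)
Lemma cvg_ultrafilters (T : Type) (S : topologicalType) (F : set_system T)
    (g : T -> S) (l : S) : Filter F ->
  (forall U, UltraFilter U -> F `<=` U -> g @ U --> l) -> g @ F --> l.
Proof.
move=> FF Ul A lA; apply: contrapT => nFA.
have PG : ProperFilter (within (~` (g @^-1` A)) F).
  apply: Build_ProperFilter_ex.
  move=> C FC; apply: contrapT => nC; apply: nFA.
  have {}FC : F [set t | ~ A (g t) -> C t] := FC.
  suff: F (g @^-1` A) by [].
  apply: filterS FC => t Ct; apply: contrapT => nA.
  by apply: nC; exists t; exact: Ct.
have [U [UU sU]] := ultraFilterLemma PG.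
have FU : F `<=` U.
  move=> C FC; apply: sU; suff: F [set t | ~ A (g t) -> C t] by [].
  by apply: filterS FC => t Ct _.
have UA : U (g @^-1` A) := Ul U UU FU A lA.
have UnA : U (~` (g @^-1` A)) by apply: sU; apply: nearW.
by have /filter_ex[t []] : U (g @^-1` A `&` ~` (g @^-1` A)) by exact: filterI.
Qed.

(** The image of an ultrafilter is an ultrafilter, here one containing the compact segment
    [-M, M]. *)
Lemma ultra_bounded_cvg (T : Type) (R : realType) (U : set_system T)
    (g : T -> R) (M : R) : UltraFilter U ->
  (forall t, `|g t| <= M) -> cvg (g @ U).
Proof.
move=> UU gM.
have gU : UltraFilter (g @ U).
  split=> [|G GF sG]; first exact: fmap_proper_filter.
  rewrite eqEsubset; split=> // A GA.
  have [//|nA] := in_ultra_setVsetC (g @^-1` A) UU.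
  have GnA : G (~` A) by exact: sG.
  by have /filter_ex[t []] : G (A `&` ~` A) by exact: filterI.
have := @segment_compact R (- M) M; rewrite compact_ultra => /(_ _ gU)[].
  by apply: nearW => t; rewrite /= in_itv/= -ler_norml.
by move=> l [_ gl]; apply/cvg_ex; exists l.
Qed.

Lemma dual_of_bounded (R : realType) (E : normedModType R) (f : E -> R^o) (C : R) :
  linear f -> (forall x, `|f x| <= C * `|x|) ->
  exists g : dual E, g = f :> (E -> R).
Proof.
move=> lf fC.
pose fl : {linear E -> R^o} := HB.pack f (GRing.isLinear.Build R E R^o *:%R f lf).
have cf : continuous fl.
  apply/linear_bounded_continuous/linear_boundedP; near=> r => x.
  by rewrite (le_trans (fC x))// ler_wpM2r//; near: r; exact: nbhs_pinfty_ge.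
have fP : f \in @dual_pred R E by rewrite inE.
by exists (Dual fP).
Unshelve. all: by end_near. Qed.

(** * Weak limits in reflexive spaces *)

Section reflexive.
Context (R : realType) (E : normedModType R).

(** The limits of [f (x t)] along [U] form a bounded linear functional of [f], that is, a point of
    the bidual; reflexivity turns it into a point of [E]. *)
Lemma ultra_reflexive_lim (T : Type) (U : set_system T) (x : T -> E) (M : R) :
  UltraFilter U -> reflexive_space E -> (forall t, `|x t| <= M) ->
  exists l : E, forall f : dual E, f (x t) @[t --> U] --> f l.
Proof.
move=> UU rE xM.
have fx (f : dual E) t : `|f (x t)| <= M * `|f|.
  rewrite (le_trans (le_dual_norm f _))// mulrC.
  by apply: (ler_wpM2r (dual_norm_ge0 f)).
have fcvg (f : dual E) : cvg (f (x t) @[t --> U]).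
  exact: ultra_bounded_cvg (fx f).
pose Phi (f : dual E) : R^o := lim (f (x t) @[t --> U]).
have linPhi : linear Phi.
  move=> a f g; rewrite /Phi; apply: cvg_lim => //.
  apply: cvgD; last exact: fcvg.
  by apply: cvgZl_tmp; exact: fcvg.
have PhiM f : `|Phi f| <= M * `|f|.
  have fn : `|f (x t)| @[t --> U] --> `|Phi f| by apply: cvg_norm; exact: fcvg.
  rewrite -(cvg_lim _ fn)//; apply: limr_le.
    by apply/cvg_ex; eexists; exact: fn.
  by apply: nearW => t; exact: fx.
have [F FE] := dual_of_bounded linPhi PhiM.
have [l Fl] := rE F; exists l => f.
by rewrite -Fl FE; exact: fcvg.
Qed.

Lemma reflexive_bounded_weak_cvg (x : E^nat) (M : R) (G : set (dual E)) :
  reflexive_space E -> (forall n, `|x n| <= M) ->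
  (forall g, G g -> cvgn (g \o x)) ->
  (forall y z, (forall g, G g -> g y = g z) -> y = z) ->
  exists l, weak_cvg x l.
Proof.
move=> rE xM Gx Gsep.
(* [U] produces the candidate [l]; convergence to it is then tested on every ultrafilter [W] finer
   than [\oo]. *)
have [U [UU NU]] := ultraFilterLemma eventually_filter.
have [l Ul] := ultra_reflexive_lim UU rE xM.
exists l => f; apply: cvg_ultrafilters => W UW NW.
have [l' Wl'] := ultra_reflexive_lim UW rE xM.
suff -> : l = l' by exact: Wl'.
apply: Gsep => g Gg.
(* A functional in [G] converges along [\oo], hence to the same limit along every finer
   ultrafilter. *)
have gV (V : set_system nat) v : UltraFilter V -> \oo `<=` V ->
    (g (x n) @[n --> V] --> g v) -> g v = lim (g \o x @ \oo).
  move=> UV NV gv.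
  have gx : g (x n) @[n --> V] --> lim (g \o x @ \oo).
    by apply: cvg_trans (Gx g Gg) => A; exact: NV.
  by rewrite -(cvg_lim _ gv)// (cvg_lim _ gx).
by rewrite (gV U l)// (gV W l').
Qed.
End reflexive.

(** * Inner products *)

(** Kept separate from any norm on [V], so that the form can be combined with an existing one. *)
Record inner_product (R : realType) (V : lmodType R) := InnerProduct {
  inner :> V -> V -> R ;
  innerP : forall a x y z, inner (a *: x + y) z = a * inner x z + inner y z ;
  innerC : forall x y, inner x y = inner y x ;
  inner_ge0 : forall x, 0 <= inner x x ;
  inner_eq0 : forall x, inner x x = 0 -> x = 0 }.

Section inner_product_theory.
Context (R : realType) (V : lmodType R) (B : inner_product V).

Lemma innerDl x y z : B (x + y) z = B x z + B y z.
Proof. by rewrite -[x]scale1r innerP mul1r scale1r. Qed.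

Lemma inner0l z : B 0 z = 0.
Proof. by apply: (addrI (B 0 z)); rewrite -innerDl !addr0. Qed.

Lemma innerZl a x z : B (a *: x) z = a * B x z.
Proof. by rewrite -[a *: x]addr0 innerP inner0l addr0. Qed.

Lemma innerBl x y z : B (x - y) z = B x z - B y z.
Proof. by rewrite innerDl -scaleN1r innerZl mulN1r. Qed.

Lemma innerDr x y z : B x (y + z) = B x y + B x z.
Proof. by rewrite innerC innerDl !(innerC _ x). Qed.

Lemma innerZr a x z : B x (a *: z) = a * B x z.
Proof. by rewrite innerC innerZl innerC. Qed.

Lemma innerBr x y z : B x (y - z) = B x y - B x z.
Proof. by rewrite innerC innerBl !(innerC _ x). Qed.

(** For nonzero [y], expand [B z z >= 0] at [z = B y y *: x - B x y *: y] and divide by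
    [B y y > 0]. *)
Lemma Cauchy_Schwarz x y : B x y ^+ 2 <= B x x * B y y.
Proof.
have [->|y0] := eqVneq y 0; first by rewrite innerC !inner0l expr0n mulr0.
have By : 0 < B y y.
  rewrite lt0r inner_ge0 andbT; apply/eqP => /inner_eq0 /eqP.
  by rewrite (negbTE y0).
have := inner_ge0 B (B y y *: x - B x y *: y).
rewrite !(innerBl, innerBr, innerZl, innerZr) (innerC _ y x).
rewrite (_ : _ - _ = B y y * (B x x * B y y - B x y ^+ 2)); last ring.
by rewrite pmulr_rge0// subr_ge0.
Qed.

(** Solved for the difference, which has to be small when the sum is nearly as long as possible. *)
Lemma inner_parallelogram x y :
  B (x - y) (x - y) = 2 * B x x + 2 * B y y - B (x + y) (x + y).
Proof. rewrite !(innerBl, innerBr, innerDl, innerDr); ring. Qed.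

End inner_product_theory.

(** * Renorming by an inner product *)

Section hilbert_renorming.
Context (R : realType) (V : normedModType R) (B : inner_product V).

(** Euclidean combination of the two norms; the squares keep the parallelogram law available for the
    part from [B]. *)
Definition sqrt_norm_inner (x : V) : R := Num.sqrt (`|x| ^+ 2 + B x x).

Let norm2D_ge0 x : 0 <= `|x| ^+ 2 + B x x.
Proof. by rewrite addr_ge0 ?sqr_ge0 ?inner_ge0. Qed.

Lemma sqr_sqrt_norm_inner x : sqrt_norm_inner x ^+ 2 = `|x| ^+ 2 + B x x.
Proof. exact: sqr_sqrtr. Qed.

Lemma sqrt_norm_innerD x y :
  sqrt_norm_inner (x + y) <= sqrt_norm_inner x + sqrt_norm_inner y.
Proof.
rewrite -ler_sqr ?nnegrE ?addr_ge0 ?sqrtr_ge0//.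
rewrite sqrrD !sqr_sqrt_norm_inner.
have nD : `|x + y| ^+ 2 <= (`|x| + `|y|) ^+ 2.
  by rewrite ler_sqr ?nnegrE ?addr_ge0// ler_normD.
(* Cauchy-Schwarz in the plane for the pairs (norm, [B]-length), combined with Cauchy-Schwarz for
   [B]. *)
have cross : `|x| * `|y| + B x y <= sqrt_norm_inner x * sqrt_norm_inner y.
  rewrite -sqrtrM; last exact: norm2D_ge0.
  apply: le_trans (ler_norm _) _; rewrite -sqrtr_sqr ler_wsqrtr//.
  have CS := Cauchy_Schwarz B x y.
  have := normr_ge0 x; have := normr_ge0 y.
  have := inner_ge0 B x; have := inner_ge0 B y.
  move: CS; move: `|x| `|y| (B x x) (B y y) (B x y) => a b p q r CS q0 p0 b0 a0.
  (* Since [r ^+ 2 <= p * q], this follows from the arithmetic-geometric mean inequality for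
     [a ^+ 2 * q] and [p * b ^+ 2], after squaring. *)
  have : 2 * (a * b * r) <= a ^+ 2 * q + p * b ^+ 2.
    have Y0 : 0 <= a ^+ 2 * q + p * b ^+ 2.
      by rewrite addr_ge0// mulr_ge0// sqr_ge0.
    apply: le_trans (ler_norm _) _; rewrite -(ger0_norm Y0).
    rewrite -ler_sqr ?nnegrE// !real_normK ?num_real//.
    have := ler_wpM2l (sqr_ge0 (2 * (a * b))) CS.
    have := sqr_ge0 (a ^+ 2 * q - p * b ^+ 2); lra.
  lra.
rewrite !(innerDl, innerDr) (innerC _ y x).
move: nD; rewrite sqrrD; lra.
Qed.

Lemma norm_le_sqrt_norm_inner x : `|x| <= sqrt_norm_inner x.
Proof.
rewrite -[leLHS]normr_id -sqrtr_sqr ler_wsqrtr// lerDl; exact: inner_ge0.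
Qed.

Lemma sqrt_norm_innerZ a x : sqrt_norm_inner (a *: x) = `|a| * sqrt_norm_inner x.
Proof.
rewrite /sqrt_norm_inner normrZ innerZl innerZr mulrA -expr2.
rewrite exprMn real_normK ?num_real// -mulrDr sqrtrM ?sqr_ge0//.
by rewrite sqrtr_sqr.
Qed.

Lemma sqrt_norm_inner_eq0 x : sqrt_norm_inner x = 0 -> x = 0.
Proof.
move=> x0; apply: normr0_eq0; apply/eqP.
by rewrite eq_le normr_ge0 andbT -x0 norm_le_sqrt_norm_inner.
Qed.

Definition norm_inner : norm_on V :=
  NormOn sqrt_norm_innerD sqrt_norm_innerZ sqrt_norm_inner_eq0.

Lemma equivalent_norm_inner (C : R) :
  (forall x, B x x <= C * `|x| ^+ 2) -> equivalent_norm norm_inner.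
Proof.
move=> BC; exists 1, (Num.sqrt (1 + `|C|)); split => //.
move=> x; rewrite mul1r norm_le_sqrt_norm_inner/=.
rewrite -[X in _ * X]normr_id -(sqrtr_sqr `|x|) -sqrtrM ?addr_ge0// ler_wsqrtr//.
rewrite mulrDl mul1r lerD2l (le_trans (BC x))//.
by rewrite ler_wpM2r ?sqr_ge0// ler_norm.
Qed.

Section W2R.
Context (C : R) (BC : forall x, B x x <= C * `|x| ^+ 2).
Context (E : {pred V}) (hE : submod_closed E).
Local Notation E0 := (subspace_of hE).
Local Notation EN := (@subspace_of R (renormed norm_inner) E hE).

(** Identity on vectors: [E0] and [EN] are the same subspace under the two norms, but distinct
    types. *)
Let toN (x : E0) : EN := @SubspaceOf R (renormed norm_inner) E hE (val x) (valP x).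
Let ofN (x : EN) : E0 := @SubspaceOf R V E hE (val x) (valP x).

Let ofNK x : toN (ofN x) = x.
Proof. exact: val_inj. Qed.

(** Equivalent norms have the same bounded functionals, so [f] on [EN] is tested through [f \o toN]
    on [E0]. *)
Lemma weak_cvg_norm_inner (x : EN^nat) (l : E0) :
  weak_cvg (ofN \o x) l -> weak_cvg x (toN l).
Proof.
move=> xl f.
have lf : linear (f \o toN : E0 -> R^o).
  move=> a u v; rewrite /= (_ : toN _ = a *: toN u + toN v); last exact: val_inj.
  exact: linearP.
have [M fM] := dual_bounded f.
have [c [D [_ _ cD]]] := equivalent_norm_inner BC.
have fb u : `|(f \o toN) u| <= (`|M| * D) * `|u|.
  rewrite /= (le_trans (fM _))// -mulrA.
  apply: le_trans (_ : `|M| * `|toN u| <= _).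
    by rewrite ler_wpM2r// ler_norm.
  rewrite ler_wpM2l//.
  by have /andP[] := cD (val u).
have [g gE] := dual_of_bounded lf fb.
have := xl g; rewrite gE /=.
by under eq_fun do rewrite ofNK.
Qed.

(** Cauchy-Schwarz and [BC] bound the functional by [|C|] times the norm of [w]. *)
Lemma inner_dual (w : E0) : exists g : dual E0, forall x, g x = B (val w) (val x).
Proof.
have lB : linear (fun x : E0 => B (val w) (val x) : R^o).
  by move=> a x y; rewrite linearP/= innerDr innerZr.
have bB (x : E0) : `|B (val w) (val x)| <= (`|C| * `|w|) * `|x|.
  have Cv (v : V) : B v v <= `|C| * `|v| ^+ 2.
    by rewrite (le_trans (BC v))// ler_wpM2r ?sqr_ge0// ler_norm.
  rewrite -ler_sqr ?nnegrE ?mulr_ge0// real_normK ?num_real//.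
  rewrite (le_trans (Cauchy_Schwarz B _ _))//.
  rewrite (_ : _ ^+ 2 = (`|C| * `|val w| ^+ 2) * (`|C| * `|val x| ^+ 2)).
    by apply: ler_pM => //; exact: inner_ge0.
  by rewrite !exprMn expr2; ring.
have [g gE] := dual_of_bounded lB bB.
by exists g => x; rewrite gE.
Qed.

Theorem W2R_norm_inner : reflexive_space E0 -> W2R EN.
Proof.
move=> rE x x1 x2.
pose y n : V := val (x n).
(* Parallelogram law for [B]; the original norm, which need not obey it, is absorbed by 2|y_m|^2 +
   2|y_n|^2 >= (|y_m| + |y_n|)^2 >= |y_m + y_n|^2. *)
have qx m n : B (y m - y n) (y m - y n) <=
    4 - `|x m + x n| ^+ 2.
  have N1 k : `|y k| ^+ 2 + B (y k) (y k) <= 1.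
    rewrite -sqr_sqrt_norm_inner -(expr1n _ 2) ler_sqr ?nnegrE ?sqrtr_ge0//.
    exact: x1.
  have -> : `|x m + x n| ^+ 2 = `|y m + y n| ^+ 2 +
      B (y m + y n) (y m + y n).
    exact: sqr_sqrt_norm_inner.
  rewrite inner_parallelogram.
  have nD : `|y m + y n| ^+ 2 <= (`|y m| + `|y n|) ^+ 2.
    by rewrite ler_sqr ?nnegrE ?addr_ge0// ler_normD.
  have := N1 m; have := N1 n; have := sqr_ge0 (`|y m| - `|y n|).
  move: nD; lra.
(* The vectors [w] range over the subspace itself, which is enough to separate its points. *)
have [|||l xl] := @reflexive_bounded_weak_cvg R E0 (ofN \o x) 1
  [set g | exists w : E0, forall y, g y = B (val w) (val y)] rE.
- move=> n; apply: le_trans (x1 n); exact: norm_le_sqrt_norm_inner.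
- move=> g [w gw].
  apply/cauchy_cvgP/cauchy_ballP => e e0.
  rewrite near_map2.
  (* By Cauchy-Schwarz and [qx] this bounds the squared increment of [g] between the indices [m] and
     [n]; it tends to 0 because the norms of the sums tend to 2. *)
  have : B (val w) (val w) * (4 - `|x mn.1 + x mn.2| ^+ 2) @[mn --> (\oo, \oo)] -->
      B (val w) (val w) * (4 - 2 ^+ 2).
    apply: cvgMr; apply: cvgB; first exact: cvg_cst.
    by rewrite expr2; under eq_fun do rewrite expr2; exact: cvgM.
  rewrite (_ : _ * (4 - 2 ^+ 2) = 0); last by ring.
  move=> /cvgr_lt /(_ (e ^+ 2)) /(_ (exprn_gt0 2 e0)).
  apply: filterS => -[m n] /= Be.
  rewrite /ball/= !gw -innerBr -ltr_sqr ?nnegrE ?(ltW e0)// real_normK ?num_real//.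
  apply: le_lt_trans Be; apply: le_trans (Cauchy_Schwarz _ _ _) _.
  by rewrite ler_wpM2l ?inner_ge0//; exact: qx.
- move=> u v uv; apply/val_inj/eqP; rewrite -subr_eq0.
  apply/eqP/(@inner_eq0 _ _ B).
  (* Testing with [w = u - v] gives [B (u - v) (u - v) = 0]. *)
  have [g gE] := inner_dual (u - v).
  have := uv g; rewrite !gE => uvE.
  rewrite [LHS]innerBr; apply/eqP; rewrite subr_eq0; apply/eqP; apply: uvE.
  by exists (u - v).
exists (toN l); exact: weak_cvg_norm_inner.
Qed.
End W2R.
End hilbert_renorming.

(** * The [L_2] inner product on [L_infty] of a probability measure *)

Lemma ae_eq_Rintegral d (T : measurableType d) (R : realType)
    (mu : {measure set T -> \bar R}) (f g : T -> R) :
  measurable_fun setT f -> measurable_fun setT g -> f = g %[ae mu] ->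
  \int[mu]_t f t = \int[mu]_t g t.
Proof.
move=> mf mg fg; rewrite /Rintegral; congr fine.
apply: ae_eq_integral => //; [exact/measurable_EFinP|exact/measurable_EFinP|].
by apply: filterS fg => t /= + Tt => /(_ Tt) ->.
Qed.

Section Linfty.
Context d (T : measurableType d) (R : realType).
Context (mu : {measure set T -> \bar R}) (mu1 : mu setT = 1%E).
Local Notation L := (LspaceType mu (leey 1%E)).
Implicit Types f g h : L.

Lemma Linfty_measurable f : measurable_fun setT (f : T -> R).
Proof. exact: measurable_aeEqMfun. Qed.

Lemma Linfty_normE f : `|f| = fine (ess_sup mu (abse \o (EFin \o f))).
Proof. by rewrite Lspace_normE unlock /Lnorm mu1 lte01. Qed.

Lemma Linfty_ess_sup_fin_num f : ess_sup mu (abse \o (EFin \o f)) \is a fin_num.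
Proof.
have : finite_norm mu +oo%E f by exact: Lebesgue_finite.
rewrite /finite_norm unlock /Lnorm.
rewrite mu1 lte01 => foo.
by rewrite ge0_fin_numE// ess_sup_gee ?mu1//; apply: nearW => s /=.
Qed.

Lemma Linfty_norm_ge f : \forall t \ae mu, `|f t| <= `|f|.
Proof.
have := @ess_sup_ge _ _ _ mu (abse \o (EFin \o f)).
apply: filterS => t /=; rewrite Linfty_normE -lee_fin fineK//.
exact: Linfty_ess_sup_fin_num.
Qed.

Lemma Linfty_norm_le f (M : R) : (\forall t \ae mu, `|f t| <= M) -> `|f| <= M.
Proof.
move=> fM; rewrite Linfty_normE -lee_fin fineK ?Linfty_ess_sup_fin_num//.
by apply/ess_supP; apply: filterS fM => t /=; rewrite lee_fin.
Qed.

Lemma LinftyM_measurable f g : measurable_fun setT (fun t => f t * g t).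
Proof. by apply: measurable_funM; exact: Linfty_measurable. Qed.

(** On a probability space bounded classes lie in [L_2], and a product of two [L_2] functions is
    integrable. *)
Lemma LinftyM_integrable f g : mu.-integrable setT (EFin \o (fun t => f t * g t)).
Proof.
have L2 h : (h : T -> R) \in Lfun mu 2%:E.
  apply: (@Lfun_subset _ _ _ mu 2%:E +oo%E); rewrite ?leey ?lee1n ?mu1//.
  exact: Lrepr_subproof.
exact/Lfun1_integrable/Lfun2_mul_Lfun1.
Qed.

Definition Linfty_inner f g : R := \int[mu]_t (f t * g t).

Lemma Linfty_innerP a f g h :
  Linfty_inner (a *: f + g) h = a * Linfty_inner f h + Linfty_inner g h.
Proof.
rewrite /Linfty_inner -RintegralZl//; last exact: LinftyM_integrable.
have afh : mu.-integrable setT (EFin \o (fun t => a * (f t * h t))).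
  exact: integrableZl (LinftyM_integrable f h).
rewrite -RintegralD//; last exact: LinftyM_integrable.
apply: ae_eq_Rintegral.
- exact: LinftyM_measurable.
- apply: measurable_funD; last exact: LinftyM_measurable.
  by apply: measurable_funM => //; exact: LinftyM_measurable.
(* The representative of [a *: f + g] is the pointwise combination only almost everywhere. *)
- apply: filterS2 (LspaceD_ae (a *: f) g) (LspaceZ_ae a f) => t + + _.
  move=> /(_ I) -> /(_ I) /= ->; ring.
Qed.

Lemma Linfty_innerC f g : Linfty_inner f g = Linfty_inner g f.
Proof. by apply: eq_Rintegral => t _; rewrite mulrC. Qed.

Lemma Linfty_inner_ge0 f : 0 <= Linfty_inner f f.
Proof. by apply: Rintegral_ge0 => t _; rewrite -expr2 sqr_ge0. Qed.

Lemma Linfty_inner_le f g : (\forall t \ae mu, `|f t| <= `|g t|) ->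
  Linfty_inner f f <= Linfty_inner g g.
Proof.
move=> fg; rewrite -lee_fin /Linfty_inner /Rintegral.
rewrite !fineK; [|exact: integrable_fin_num (LinftyM_integrable _ _)..].
apply: ae_ge0_le_integral => //.
- by move=> t _; rewrite lee_fin -expr2 sqr_ge0.
- exact/measurable_EFinP/LinftyM_measurable.
- by move=> t _; rewrite lee_fin -expr2 sqr_ge0.
- exact/measurable_EFinP/LinftyM_measurable.
apply: filterS fg => t ft _; rewrite lee_fin -!expr2.
by rewrite -real_normK ?num_real// -[leRHS]real_normK ?num_real// ler_sqr ?nnegrE.
Qed.

Lemma Linfty_inner_eq0 f : Linfty_inner f f = 0 -> f = 0.
Proof.
move=> f0; apply: LspaceP.
have abs0 : (\int[mu]_t `|(f t * f t)%:E| = 0)%E.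
  under eq_integral => t _ do
    rewrite gee0_abs ?lee_fin -?expr2 ?sqr_ge0// expr2.
  (* Finiteness of the integral lifts the vanishing of its [fine] to the extended reals. *)
  rewrite -[LHS]fineK; first by congr EFin.
  exact: integrable_fin_num (LinftyM_integrable f f).
have mff : measurable_fun setT (EFin \o (fun t => f t * f t)).
  exact/measurable_EFinP/LinftyM_measurable.
have ff0 := (ae_eq_integral_abs mu measurableT mff).1 abs0.
apply: filterS2 ff0 (Lspace0_ae mu (leey 1%E)) => t + + _.
move=> /(_ I) /= [ff] /(_ I) ->.
by move/eqP: ff; rewrite mulf_eq0 orbb => /eqP.
Qed.

Definition Linfty_inner_product : inner_product L :=
  InnerProduct Linfty_innerP Linfty_innerC Linfty_inner_ge0 Linfty_inner_eq0.

(** As the total mass is 1, the a.e. bound on the square of [f] passes to its integral without a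
    constant. *)
Lemma Linfty_inner_le_norm f : Linfty_inner f f <= `|f| ^+ 2.
Proof.
rewrite -lee_fin /Linfty_inner /Rintegral.
rewrite fineK; last exact: integrable_fin_num (LinftyM_integrable _ _).
have -> : ((`|f| ^+ 2)%:E = \int[mu]_t cst (`|f| ^+ 2)%:E t)%E.
  by rewrite integral_cst// mu1 mule1.
apply: ae_ge0_le_integral => //.
- by move=> t _; rewrite lee_fin -expr2 sqr_ge0.
- exact/measurable_EFinP/LinftyM_measurable.
- by move=> t _; rewrite lee_fin sqr_ge0.
apply: filterS (Linfty_norm_ge f) => t ft _; rewrite lee_fin -!expr2.
by rewrite -real_normK ?num_real// ler_sqr ?nnegrE.
Qed.

(** The essential supremum is the infimum of the levels that |f| exceeds only on a null set, so it
    depends on the distribution of |f| alone. *)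
Lemma Linfty_norm_distribution f g :
  (forall B : set R, measurable B ->
      mu [set t | B `|f t|] = mu [set t | B `|g t|]) -> `|f| = `|g|.
Proof.
move=> fg; rewrite !Linfty_normE !ess_supEmu0; last 2 first.
- by apply: measurableT_comp => //; exact/measurable_EFinP/Linfty_measurable.
- by apply: measurableT_comp => //; exact/measurable_EFinP/Linfty_measurable.
have E y : mu ((abse \o (EFin \o f)) @^-1` `]y, +oo[) =
           mu ((abse \o (EFin \o g)) @^-1` `]y, +oo[).
  apply: (fg (EFin @^-1` `]y, +oo[)); rewrite -[X in measurable X]setTI.
  apply: (@EFin_measurable R setT) => //; exact: emeasurable_itv.
by congr (fine (ereal_inf _)); apply/seteqP; split=> y /=; rewrite E.
Qed.

(** Both sides integrate [r ^+ 2] against the image measure of the absolute value. *)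
Lemma Linfty_inner_distribution f g :
  (forall B : set R, measurable B ->
      mu [set t | B `|f t|] = mu [set t | B `|g t|]) ->
  Linfty_inner f f = Linfty_inner g g.
Proof.
move=> fg.
have mn h : measurable_fun setT (fun t => `|h t|).
  by apply: measurableT_comp => //; exact: Linfty_measurable.
have E h : (\int[mu]_t (h t * h t)%:E =
    \int[pushforward mu (fun t => `|h t|%R)]_r (r ^+ 2)%:E)%E.
  rewrite [RHS]ge0_integral_pushforward//.
  - by apply: eq_integral => t _ /=; rewrite real_normK ?num_real// expr2.
  - by apply/measurable_EFinP; exact: measurable_funX.
  - by move=> r _; rewrite lee_fin sqr_ge0.
rewrite /Linfty_inner /Rintegral !E; congr fine.
by apply: eq_measure_integral => A mA _; exact: fg.
Qed.

End Linfty.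

(** * The norm on [L_infty] of the unit interval *)

Theorem corollary5p4 (R : realType) :
  exists N : norm_on (Linfty01 R),
    [/\ equivalent_norm N, rearrangement_invariant N &
      forall (E : {pred Linfty01 R}) (hE : submod_closed E),
        closed [set f | f \in E] ->
        reflexive_space (subspace_of hE) ->
        W2R (@subspace_of R (renormed N) E hE)].
Proof.
have mu1 : leb01 R setT = 1%E.
  rewrite (_ : leb01 R setT = lebesgue_measure (setT `&` `[0%R, 1%R])%classic)//.
  by rewrite setTI lebesgue_measure_itv/= lte01 sube0.
exists (norm_inner (Linfty_inner_product mu1)); split.
- apply: (equivalent_norm_inner (C := 1)) => f; rewrite mul1r.
  exact: Linfty_inner_le_norm.
(* Both terms under the square root are monotone in |f| and determined by its distribution. *)
- split=> f g fg /=; rewrite /sqrt_norm_inner/=.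
    rewrite ler_wsqrtr// lerD ?(Linfty_inner_le mu1)// ler_sqr ?nnegrE//.
    apply: (Linfty_norm_le mu1).
    by apply: filterS2 fg (Linfty_norm_ge mu1 g) => t; exact: le_trans.
  by rewrite (Linfty_norm_distribution mu1 fg) (Linfty_inner_distribution fg).
- move=> E hE _; apply: (W2R_norm_inner (C := 1)) => f; rewrite mul1r.
  exact: Linfty_inner_le_norm.
Qed.
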